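(* Let $k$ be an algebraically closed field, $Q$ a finite quiver, $I\subset kQ$ an admissible ideal, $B=kQ/I$ and $n=\dim_kB$. Then the variety $\operatorname{AlgGr}_{n-1}(B)$ of maximal subalgebras of $B$ is a finite union of $\operatorname{Aut}_k(B)$-orbits if one of the following conditions holds: (1) $Q$ is Schur; (2) $I$ is monomial.
   Context: Algebras are unital, associative, finite-dimensional over $k$; subalgebras contain the unit. $\operatorname{AlgGr}_m(B)$ is the variety of $m$-dimensional subalgebras of $B$, closed in the Grassmannian $\operatorname{Gr}_m(B)$; $\operatorname{Aut}_k(B)$, the group of $k$-algebra automorphisms, acts by $A\mapsto\phi(A)$. For $B=kQ/I$ the $(n-1)$-dimensional subalgebras are exactly the maximal subalgebras; the paper denotes the variety $\operatorname{AlgGr}_{n-1}(B)$ by $\mathfrak{msa}(Q)$, since up to isomorphism it depends only on $Q$. $kQ$ is the path algebra, $J(Q)$ its two-sided ideal generated by the arrows, and $I$ is admissible if $J(Q)^2\supset I\supset J(Q)^\ell$ for some $\ell\ge2$. $Q$ is Schur if for all vertices $u,v$ there is at most one arrow with source $u$ and target $v$. $I$ is monomial if it is generated by paths. *)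

(* Defs.v *)
From HB Require Import structures.
From mathcomp Require Import all_boot all_order all_algebra all_field finmap.
From mathcomp Require Import boolp classical_sets.
From mathcomp Require Import monalg.

Set Implicit Arguments.
Unset Strict Implicit.
Unset Printing Implicit Defensive.

Import GRing.Theory.
Local Open Scope ring_scope.
Local Open Scope classical_set_scope.

(* A quiver has at least one vertex, so that its path algebra is a nonzero
   ring, as [nzRingType] requires. *)
Record quiver := Quiver {
  vertex : finType;
  arrow : finType;
  src : arrow -> vertex;
  tgt : arrow -> vertex;
  vertex_gt0 : (0 < #|vertex|)%N }.

Definition schur (Q : quiver) : Prop :=
  forall a b : arrow Q, src a = src b -> tgt a = tgt b -> a = b.

Section Paths.
Variable Q : quiver.
Implicit Types (v : vertex Q) (s : seq (arrow Q)).

Fixpoint walk v s : bool :=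
  if s is a :: s' then (src a == v) && walk (tgt a) s' else true.

Definition walk_end v s : vertex Q := last v (map (@tgt Q) s).

(* A path is its starting vertex together with its arrows listed in the order
   in which they are traversed; (v, [::]) is the trivial path at v. *)
Record qpath := QPath {
  qpath_val : vertex Q * seq (arrow Q);
  qpath_walk : walk qpath_val.1 qpath_val.2 }.

HB.instance Definition _ := [isSub for qpath_val].
HB.instance Definition _ := [Countable of qpath by <:].

Definition psrc (p : qpath) : vertex Q := (val p).1.
Definition parr (p : qpath) : seq (arrow Q) := (val p).2.
Definition ptgt (p : qpath) : vertex Q := walk_end (psrc p) (parr p).

Definition trivial_path v : qpath := @QPath (v, [::]) isT.

Lemma arrow_walk (a : arrow Q) : walk (src a) [:: a].
Proof. by rewrite /= eqxx. Qed.

Definition arrow_path (a : arrow Q) : qpath := @QPath (src a, [:: a]) (arrow_walk a).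

(* First p, then q; meaningful only when ptgt p = psrc q. *)
Definition pcat (p q : qpath) : qpath := insubd p (psrc p, parr p ++ parr q).

Lemma walk_cat v s1 s2 :
  walk v (s1 ++ s2) = walk v s1 && walk (walk_end v s1) s2.
Proof.
by elim: s1 v => [|a s1 IHs] v //=; rewrite IHs andbA.
Qed.

Lemma walk_end_cat v s1 s2 :
  walk_end v (s1 ++ s2) = walk_end (walk_end v s1) s2.
Proof. by rewrite /walk_end map_cat last_cat. Qed.

Lemma val_pcat p q : ptgt p = psrc q -> val (pcat p q) = (psrc p, parr p ++ parr q).
Proof.
move=> pq; apply: insubdK; rewrite unfold_in /= walk_cat.
by rewrite (qpath_walk p) /=; move: pq; rewrite /ptgt => ->; exact: (qpath_walk q).
Qed.

Lemma psrc_pcat p q : ptgt p = psrc q -> psrc (pcat p q) = psrc p.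
Proof. by move=> pq; rewrite {1}/psrc val_pcat. Qed.

Lemma parr_pcat p q : ptgt p = psrc q -> parr (pcat p q) = parr p ++ parr q.
Proof. by move=> pq; rewrite {1}/parr val_pcat. Qed.

Lemma ptgt_pcat p q : ptgt p = psrc q -> ptgt (pcat p q) = ptgt q.
Proof.
move=> pq; rewrite {1}/ptgt psrc_pcat // parr_pcat // walk_end_cat.
by move: pq; rewrite {1}/ptgt => ->.
Qed.

Lemma qpathP p q : psrc p = psrc q -> parr p = parr q -> p = q.
Proof.
rewrite /psrc /parr => e1 e2; apply: val_inj.
by rewrite [LHS]surjective_pairing [RHS]surjective_pairing e1 e2.
Qed.

Lemma pcatA p q r : ptgt p = psrc q -> ptgt q = psrc r ->
  pcat p (pcat q r) = pcat (pcat p q) r.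
Proof.
move=> pq qr; have pqr : ptgt p = psrc (pcat q r) by rewrite psrc_pcat.
have pqr' : ptgt (pcat p q) = psrc r by rewrite ptgt_pcat.
by apply: qpathP; rewrite ?psrc_pcat ?parr_pcat // catA.
Qed.

Lemma pcat1p p : pcat (trivial_path (psrc p)) p = p.
Proof. by apply: qpathP; rewrite ?psrc_pcat ?parr_pcat. Qed.

Lemma pcatp1 p : pcat p (trivial_path (ptgt p)) = p.
Proof. by apply: qpathP; rewrite ?psrc_pcat ?parr_pcat //= cats0. Qed.

End Paths.

(* kQ: finitely supported functions from paths to k. *)
Definition path_algebra (k : fieldType) (Q : quiver) := {malg k[qpath Q]}.

HB.instance Definition _ (k : fieldType) (Q : quiver) :=
  GRing.Lmodule.on (path_algebra k Q).

HB.lock Definition pbasis (k : fieldType) (Q : quiver) (p : qpath Q) :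
  path_algebra k Q := << p >>.

Definition pbasis_mul (k : fieldType) (Q : quiver) (p q : qpath Q) :
    path_algebra k Q :=
  if ptgt p == psrc q then pbasis k (pcat p q) else 0.

HB.lock Definition pa_mul (k : fieldType) (Q : quiver) (f g : path_algebra k Q) :
    path_algebra k Q :=
  \sum_(p <- msupp f) \sum_(q <- msupp g) (f@_p * g@_q) *: pbasis_mul k p q.

Definition pa_one (k : fieldType) (Q : quiver) : path_algebra k Q :=
  \sum_(v : vertex Q) pbasis k (trivial_path v).

Section PathAlgebra.
Variables (k : fieldType) (Q : quiver).
Local Notation kQ := (path_algebra k Q).
Local Notation pbasis := (pbasis k).
Local Notation pbasis_mul := (pbasis_mul k).
Implicit Types (f g h : kQ) (p q r : qpath Q).

Lemma mcoeff_pbasis p q : (pbasis p)@_q = (p == q)%:R.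
Proof. by rewrite pbasis.unlock mcoeffU. Qed.

Lemma msupp_pbasis p : msupp (pbasis p) = [fset p]%fset.
Proof. by rewrite pbasis.unlock msuppU oner_eq0. Qed.

Lemma pa_mulw (d1 d2 : {fset qpath Q}) f g :
  (msupp f `<=` d1)%fset -> (msupp g `<=` d2)%fset ->
  pa_mul f g = \sum_(p <- d1) \sum_(q <- d2) (f@_p * g@_q) *: pbasis_mul p q.
Proof.
move=> le_d1 le_d2; rewrite pa_mul.unlock (big_fset_incl _ le_d1) /=.
  apply/eq_bigr=> k1 _; apply/big_fset_incl => // x _ /mcoeff_outdom ->.
  by rewrite mulr0 scale0r.
move=> x _ /mcoeff_outdom fx.
by rewrite big1 => // k' _; rewrite fx mul0r scale0r.
Qed.

Lemma pa_mulDl : left_distributive (@pa_mul k Q) +%R.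
Proof.
move=> f g h.
rewrite (@pa_mulw (msupp f `|` msupp g)%fset (msupp h)) ?msuppD_le //.
rewrite (@pa_mulw (msupp f `|` msupp g)%fset (msupp h) f) ?fsubsetUl //.
rewrite (@pa_mulw (msupp f `|` msupp g)%fset (msupp h) g) ?fsubsetUr //.
rewrite -big_split /=; apply/eq_bigr=> p _.
rewrite -big_split /=; apply/eq_bigr=> q _.
by rewrite mcoeffD mulrDl scalerDl.
Qed.

Lemma pa_mulDr : right_distributive (@pa_mul k Q) +%R.
Proof.
move=> h f g.
rewrite (@pa_mulw (msupp h) (msupp f `|` msupp g)%fset) ?msuppD_le //.
rewrite (@pa_mulw (msupp h) (msupp f `|` msupp g)%fset h f) ?fsubsetUl //.
rewrite (@pa_mulw (msupp h) (msupp f `|` msupp g)%fset h g) ?fsubsetUr //.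
rewrite -big_split /=; apply/eq_bigr=> p _.
rewrite -big_split /=; apply/eq_bigr=> q _.
by rewrite mcoeffD mulrDr scalerDl.
Qed.

Lemma pa_mulZl c f g : pa_mul (c *: f) g = c *: pa_mul f g.
Proof.
rewrite !(@pa_mulw (msupp f) (msupp g)) ?msuppZ_le //.
rewrite scaler_sumr; apply: eq_bigr => p _; rewrite scaler_sumr.
by apply: eq_bigr => q _; rewrite mcoeffZ scalerA mulrA.
Qed.

Lemma pa_mulZr c f g : pa_mul f (c *: g) = c *: pa_mul f g.
Proof.
rewrite !(@pa_mulw (msupp f) (msupp g)) ?msuppZ_le //.
rewrite scaler_sumr; apply: eq_bigr => p _; rewrite scaler_sumr.
by apply: eq_bigr => q _; rewrite mcoeffZ scalerA mulrCA.
Qed.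

Lemma pa_mul0l f : pa_mul 0 f = 0.
Proof. by rewrite -(scale0r (0 : kQ)) pa_mulZl !scale0r. Qed.

Lemma pa_mul0r f : pa_mul f 0 = 0.
Proof. by rewrite -(scale0r (0 : kQ)) pa_mulZr !scale0r. Qed.

Lemma pa_mulUU p q : pa_mul (pbasis p) (pbasis q) = pbasis_mul p q.
Proof.
rewrite pa_mul.unlock !msupp_pbasis !big_seq_fset1.
by rewrite !mcoeff_pbasis !eqxx mulr1 scale1r.
Qed.

Lemma pbasisE f : f = \sum_(p <- msupp f) f@_p *: pbasis p.
Proof.
rewrite {1}[f]monalgE; apply: eq_bigr => p _; apply/malgP => q.
by rewrite (mcoeffZ (f@_p)) mcoeff_pbasis (mcoeffU p (f@_p)) mulr_natr.
Qed.

Lemma pa_mul_suml (I : Type) (s : seq I) (F : I -> kQ) g :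
  pa_mul (\sum_(i <- s) F i) g = \sum_(i <- s) pa_mul (F i) g.
Proof. by elim/big_rec2: _ => [|i x y _ <-]; rewrite ?pa_mul0l ?pa_mulDl. Qed.

Lemma pa_mul_sumr (I : Type) (s : seq I) (F : I -> kQ) g :
  pa_mul g (\sum_(i <- s) F i) = \sum_(i <- s) pa_mul g (F i).
Proof. by elim/big_rec2: _ => [|i x y _ <-]; rewrite ?pa_mul0r ?pa_mulDr. Qed.

Lemma pbasis_mulA p q r :
  pa_mul (pbasis p) (pbasis_mul q r) = pa_mul (pbasis_mul p q) (pbasis r).
Proof.
rewrite /pbasis_mul; case: (ptgt q =P psrc r) => [qr|nqr].
  case: (ptgt p =P psrc q) => [pq|npq].
    rewrite !pa_mulUU.
    rewrite /pbasis_mul.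
    rewrite (psrc_pcat qr).
    rewrite (ptgt_pcat pq).
    rewrite pq qr !eqxx.
    by rewrite pcatA.
  rewrite pa_mul0l pa_mulUU /pbasis_mul psrc_pcat //.
  by case: eqP npq.
rewrite pa_mul0r; case: (ptgt p =P psrc q) => [pq|_]; last by rewrite pa_mul0l.
by rewrite pa_mulUU /pbasis_mul ptgt_pcat //; case: eqP nqr.
Qed.

Lemma pa_mul_expl f g :
  pa_mul f g = \sum_(p <- msupp f) f@_p *: pa_mul (pbasis p) g.
Proof.
rewrite {1}(pbasisE f) (pa_mul_suml _ _ g); apply: eq_bigr => p _.
by rewrite pa_mulZl.
Qed.

Lemma pa_mul_expr f g :
  pa_mul f g = \sum_(p <- msupp g) g@_p *: pa_mul f (pbasis p).
Proof.
rewrite {1}(pbasisE g) (pa_mul_sumr _ _ f); apply: eq_bigr => p _.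
by rewrite pa_mulZr.
Qed.

Lemma pa_mulA : associative (@pa_mul k Q).
Proof.
move=> f g h; rewrite (pa_mul_expl f (pa_mul g h)) (pa_mul_expl f g).
rewrite (pa_mul_suml _ _ h); apply: eq_bigr => p _.
rewrite pa_mulZl (pa_mul_expl g h) (pa_mul_expr _ g); congr (_ *: _).
rewrite (pa_mul_sumr _ _ (pbasis p)) (pa_mul_suml _ _ h).
apply: eq_bigr => q _; rewrite pa_mulZr pa_mulZl; congr (_ *: _).
rewrite (pa_mul_expr (pbasis q) h) (pa_mul_expr _ h) (pa_mul_sumr _ _ (pbasis p)).
apply: eq_bigr => r _; rewrite pa_mulZr; congr (_ *: _).
by rewrite !pa_mulUU pbasis_mulA.
Qed.

Lemma pa_mul1l : left_id (pa_one k Q) (@pa_mul k Q).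
Proof.
move=> f; rewrite pa_mul_expr [RHS]pbasisE.
apply: eq_bigr => p _; congr (_ *: _).
rewrite pa_mul_suml (bigD1 (psrc p)) //= pa_mulUU /pbasis_mul eqxx pcat1p.
by rewrite big1 ?addr0 // => v /negPf nv; rewrite pa_mulUU /pbasis_mul nv.
Qed.

Lemma pa_mul1r : right_id (pa_one k Q) (@pa_mul k Q).
Proof.
move=> f; rewrite pa_mul_expl [RHS]pbasisE.
apply: eq_bigr => p _; congr (_ *: _).
rewrite pa_mul_sumr (bigD1 (ptgt p)) //= pa_mulUU /pbasis_mul eqxx pcatp1.
rewrite big1 ?addr0 // => v /negPf nv.
by rewrite pa_mulUU /pbasis_mul eq_sym nv.
Qed.

Lemma pa_one_coef v : (pa_one k Q)@_(trivial_path v) = 1.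
Proof.
rewrite /pa_one (raddf_sum (mcoeff (trivial_path v))) (bigD1 v) //=.
rewrite mcoeff_pbasis eqxx big1 ?addr0 // => u uv.
rewrite mcoeff_pbasis; case: eqP => // -[uv'].
by rewrite uv' eqxx in uv.
Qed.

Lemma pa_one_neq0 : pa_one k Q != 0.
Proof.
have /card_gt0P [v _] := vertex_gt0 Q.
apply/eqP => /(congr1 (mcoeff (trivial_path v))); rewrite pa_one_coef mcoeff0.
by move/eqP; rewrite oner_eq0.
Qed.

HB.instance Definition _ := GRing.Zmodule_isNzRing.Build kQ
  pa_mulA pa_mul1l pa_mul1r pa_mulDl pa_mulDr pa_one_neq0.

HB.instance Definition _ := GRing.Lmodule_isLalgebra.Build k kQ
  (fun c f g => esym (pa_mulZl c f g)).

HB.instance Definition _ := GRing.Lalgebra_isAlgebra.Build k kQ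
  (fun c f g => esym (pa_mulZr c f g)).

Lemma pbasisM p q : pbasis p * pbasis q = pbasis_mul p q.
Proof. exact: pa_mulUU. Qed.

Lemma mcoeff_triv_mul v f g :
  (f * g)@_(trivial_path v) = f@_(trivial_path v) * g@_(trivial_path v).
Proof.
pose c := mcoeff (trivial_path v) : kQ -> k.
have cM p q : c (pbasis_mul p q) = c (pbasis p) * c (pbasis q).
  rewrite /c !mcoeff_pbasis /pbasis_mul.
  case: (ptgt p =P psrc q) => [pq|npq]; last first.
    rewrite mcoeff0; case: eqP => [e|]; last by rewrite mul0r.
    case: eqP => [e'|]; last by rewrite mulr0.
    by case: npq; rewrite e e'.
  rewrite mcoeff_pbasis; case: (p =P _) => [e|ne]; last first.
    rewrite mul0r; case: eqP => // e; case: ne; apply: qpathP.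
      by rewrite -(psrc_pcat pq) e.
    by move: (parr_pcat pq); rewrite e /=; case: (parr p).
  rewrite mul1r; congr (1 *+ _); apply: f_equal.
  have -> : pcat p q = q by move: pq; rewrite e => pq; rewrite -[RHS]pcat1p -pq.
  by [].
rewrite -/(c (f * g)) -/(c f) -/(c g).
have cZ a h : c (a *: h) = a * c h by exact: mcoeffZ.
have cs (s : {fset qpath Q}) F : c (\sum_(p <- s) F p) = \sum_(p <- s) c (F p).
  exact: raddf_sum.
have cE h : c h = \sum_(p <- msupp h) h@_p * c (pbasis p).
  by rewrite {1}(pbasisE h) cs; apply: eq_bigr => p _; rewrite cZ.
have -> : f * g = \sum_(p <- msupp f) \sum_(q <- msupp g)
    (f@_p * g@_q) *: pbasis_mul p q.
  by rewrite -[LHS]/(pa_mul f g) pa_mul.unlock.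
rewrite cs (cE f) (cE g) mulr_suml.
apply: eq_bigr => p _; rewrite cs mulr_sumr.
by apply: eq_bigr => q _; rewrite cZ cM mulrACA.
Qed.

End PathAlgebra.

Section Ideals.
Variable R : nzRingType.
Implicit Types (I J G : set R).

Definition two_sided_ideal I : Prop :=
  [/\ I 0, forall x y, I x -> I y -> I (x + y),
      forall a x, I x -> I (a * x) & forall a x, I x -> I (x * a)].

Definition ideal_gen G : set R := smallest two_sided_ideal G.

Definition ideal_mul I J : set R := ideal_gen [set x * y | x in I & y in J].

Definition ideal_pow I (n : nat) : set R := iter n (ideal_mul I) setT.

Lemma ideal_genP G : two_sided_ideal (ideal_gen G).
Proof.
split=> [M [[]]//|x y Gx Gy M [idM GM]|a x Gx M [idM GM]|a x Gx M [idM GM]];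
  have := idM; case=> M0 MD Ml Mr; [apply: MD|apply: Ml|apply: Mr];
  by [exact: Gx|exact: Gy].
Qed.

Lemma ideal_powP I n : two_sided_ideal (ideal_pow I n).
Proof. by case: n => [|n]; [split|exact: ideal_genP]. Qed.

Lemma ideal_pow_mul I n x y : I x -> ideal_pow I n y -> ideal_pow I n.+1 (x * y).
Proof. by move=> Ix Iy; apply: sub_gen_smallest; exists x => //; exists y. Qed.

End Ideals.

Section Admissible.
Variables (k : fieldType) (Q : quiver).
Local Notation kQ := (path_algebra k Q).

Definition arrow_ideal : set kQ :=
  ideal_gen (range (fun a : arrow Q => pbasis k (arrow_path a))).

Definition admissible (I : set kQ) : Prop :=
  exists l : nat, [/\ (2 <= l)%N, ideal_pow arrow_ideal l `<=` I &
                      I `<=` ideal_pow arrow_ideal 2].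

Definition monomial (I : set kQ) : Prop :=
  exists P : set (qpath Q), I = ideal_gen [set pbasis k p | p in P].

Record admissible_ideal := AdmissibleIdeal {
  ideal_set :> set kQ;
  ideal_setP : two_sided_ideal ideal_set;
  ideal_set_admissible : admissible ideal_set }.

End Admissible.

Arguments arrow_ideal : clear implicits.

(* Every image of a finite-dimensional space is finite-dimensional. *)
Lemma vector_axiom_image (k : fieldType) (N : nat) (V : lmodType k)
    (g : {linear 'rV[k]_N -> V}) :
  (forall x, exists u, g u = x) -> {n & Vector.axiom n V}.
Proof.
move=> gsurj.
have [K Kg] : {K : {vspace 'rV[k]_N} | forall u, (u \in K) = (g u == 0)}.
  apply: cid.
  pose P n := `[< exists2 K : {vspace 'rV[k]_N},
    \dim K = n & forall u, u \in K -> g u = 0 >].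
  have exP : exists n, P n.
    exists 0%N; apply/asboolP; exists 0%VS; first by rewrite dimv0.
    by move=> u; rewrite memv0 => /eqP ->; rewrite linear0.
  have ubP n : P n -> (n <= \dim {:'rV[k]_N})%N.
    by move=> /asboolP [K <- _]; rewrite dimvS ?subvf.
  have [n /asboolP [K Kn Kg] nmax] := ex_maxnP exP ubP.
  exists K => u; apply/idP/eqP => [/Kg//|gu0].
  have : P (\dim (K + <[u]>)%VS).
    apply/asboolP; exists (K + <[u]>)%VS => // w /memv_addP [x xK [y]].
    by move=> /vlineP [c ->] ->; rewrite linearD linearZ /= gu0 scaler0 addr0 Kg.
  move=> /nmax; rewrite -Kn => le; apply: subvP (memv_line u).
  have /eqP -> : K == (K + <[u]>)%VS by rewrite eqEdim addvSl le.
  exact: addvSr.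
pose C := (K^C)%VS; exists (\dim C).
have inC x : exists u, (u \in C) && (g u == x).
  have [u gu] := gsurj x.
  have : u \in (K + C)%VS by rewrite addv_complf memvf.
  move=> /memv_addP [y yK [w wC uE]]; exists w; rewrite wC /=.
  by move: yK; rewrite Kg => /eqP gy; rewrite -gu uE linearD gy /= add0r.
pose s x := xchoose (inC x).
have sC x : s x \in C by have /andP [] := xchooseP (inC x).
have gs x : g (s x) = x by have /andP [_ /eqP] := xchooseP (inC x).
have sU u : u \in C -> s (g u) = u.
  move=> uC; apply/eqP; rewrite -subr_eq0 -memv0 -(capv_compl K) memv_cap.
  by rewrite Kg linearB gs /= subrr eqxx memvB.
have slin : linear s.
  move=> a x y; rewrite -[in LHS](gs x) -[in LHS](gs y) -linearP sU //.
  by rewrite memvD ?memvZ.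
have [h hlin hbij] := subvs_vect_iso C.
exists (fun x => h (vsproj C (s x))).
  by move=> a x y; rewrite slin linearP hlin.
apply: (bij_comp hbij).
exists (fun w => g (vsval w)) => [x|w]; first by rewrite vsprojK ?gs.
by apply: val_inj; rewrite /= vsprojK ?sU ?subvsP.
Qed.

Definition ideal_pred (k : fieldType) (Q : quiver) (I : admissible_ideal k Q) :
  {pred path_algebra k Q} := fun x => `[< ideal_set I x >].

Fact ideal_pred_zmod_closed (k : fieldType) (Q : quiver) (I : admissible_ideal k Q) :
  zmod_closed (ideal_pred I).
Proof.
have [I0 ID Il Ir] := ideal_setP I.
split=> [|x y /asboolP Ix /asboolP Iy]; apply/asboolP; first exact: I0.
by apply: ID => //; rewrite -mulN1r; apply: Il.
Qed.

HB.instance Definition _ (k : fieldType) (Q : quiver) (I : admissible_ideal k Q) :=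
  GRing.isZmodClosed.Build (path_algebra k Q) (ideal_pred I)
    (ideal_pred_zmod_closed I).

Definition quiver_algebra (k : fieldType) (Q : quiver) (I : admissible_ideal k Q) :=
  @Quotient.quot (path_algebra k Q) (ideal_pred I).

Section QuiverAlgebra.
Variables (k : fieldType) (Q : quiver) (I : admissible_ideal k Q).
Local Notation kQ := (path_algebra k Q).
Local Notation B := (quiver_algebra I).
Local Open Scope quotient_scope.

HB.instance Definition _ := GRing.Zmodule.on B.

Definition qa_pi (x : kQ) : B := \pi_B x.

Lemma qa_piE x y : (qa_pi x = qa_pi y) <-> ideal_set I (x - y).
Proof.
split=> [/eqP|Ixy]; last apply/eqP.
  by rewrite -Quotient.idealrBE => /asboolP.
by rewrite -Quotient.idealrBE; apply/asboolP.
Qed.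

Lemma qa_reprK (b : B) : qa_pi (repr b) = b.
Proof. exact: reprK. Qed.

Lemma qa_piD : {morph qa_pi : x y / x + y >-> x + y}.
Proof. by move=> x y; exact: raddfD. Qed.

Lemma qa_pi0 : qa_pi 0 = 0.
Proof. exact: raddf0. Qed.

Lemma qa_repr_pi x : ideal_set I (repr (qa_pi x) - x).
Proof. by apply/qa_piE; rewrite qa_reprK. Qed.

Definition qa_mul (x y : B) : B := qa_pi (repr x * repr y).
Definition qa_scale (c : k) (x : B) : B := qa_pi (c *: repr x).

Lemma ideal_setZ (c : k) x : ideal_set I x -> ideal_set I (c *: x).
Proof.
move=> Ix; have [_ _ Il _] := ideal_setP I.
by rewrite -[x]mul1r scalerAl; apply: Il.
Qed.

Lemma qa_piM x y : qa_mul (qa_pi x) (qa_pi y) = qa_pi (x * y).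
Proof.
have [I0 ID Il Ir] := ideal_setP I; apply/qa_piE.
have -> (a b : kQ) : a * b - x * y = (a - x) * b + x * (b - y).
  by rewrite mulrBl mulrBr addrA subrK.
by apply: ID; [apply: Ir|apply: Il]; exact: qa_repr_pi.
Qed.

Lemma qa_piZ c x : qa_scale c (qa_pi x) = qa_pi (c *: x).
Proof. by apply/qa_piE; rewrite -scalerBr; apply/ideal_setZ/qa_repr_pi. Qed.

Lemma qa_mulA : associative qa_mul.
Proof.
by move=> x y z; rewrite -[x]qa_reprK -[y]qa_reprK -[z]qa_reprK !qa_piM mulrA.
Qed.

Lemma qa_mul1l : left_id (qa_pi 1) qa_mul.
Proof. by move=> x; rewrite -[x]qa_reprK qa_piM mul1r. Qed.

Lemma qa_mul1r : right_id (qa_pi 1) qa_mul.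
Proof. by move=> x; rewrite -[x]qa_reprK qa_piM mulr1. Qed.

Lemma qa_mulDl : left_distributive qa_mul +%R.
Proof.
move=> x y z; rewrite -[x]qa_reprK -[y]qa_reprK -[z]qa_reprK.
by rewrite -qa_piD !qa_piM -qa_piD mulrDl.
Qed.

Lemma qa_mulDr : right_distributive qa_mul +%R.
Proof.
move=> x y z; rewrite -[x]qa_reprK -[y]qa_reprK -[z]qa_reprK.
by rewrite -qa_piD !qa_piM -qa_piD mulrDr.
Qed.

Lemma qa_one_neq0 : qa_pi 1 != 0.
Proof.
have [l [_ _ IJ]] := ideal_set_admissible I.
have /card_gt0P [v _] := vertex_gt0 Q.
pose Z : set kQ := [set f | f@_(trivial_path v) = 0].
have idZ : two_sided_ideal Z.
  split=> [|x y|a x|a x]; rewrite /Z /= ?mcoeff0 ?mcoeffD ?mcoeff_triv_mul //.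
  - by move=> -> ->; rewrite addr0.
  - by move=> ->; rewrite mulr0.
  - by move=> ->; rewrite mul0r.
have JZ : arrow_ideal k Q `<=` Z.
  apply: smallest_sub => // _ [a _ <-]; rewrite /Z /= mcoeff_pbasis.
  by case: eqP.
apply/eqP; rewrite -qa_pi0 => /qa_piE; rewrite subr0 => /IJ.
have sZ : ideal_pow (arrow_ideal k Q) 2 `<=` Z.
  apply: smallest_sub => // _ [x /JZ Zx [y _ <-]].
  by have [_ _ _ Zr] := idZ; apply: Zr.
by move=> /sZ; rewrite /Z /= pa_one_coef => /eqP; rewrite oner_eq0.
Qed.

HB.instance Definition _ := GRing.Zmodule_isNzRing.Build B
  qa_mulA qa_mul1l qa_mul1r qa_mulDl qa_mulDr qa_one_neq0.

Lemma qa_scaleA a b x : qa_scale a (qa_scale b x) = qa_scale (a * b) x.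
Proof. by rewrite -[x]qa_reprK !qa_piZ scalerA. Qed.

Lemma qa_scale1 : left_id 1 qa_scale.
Proof. by move=> x; rewrite -[x]qa_reprK qa_piZ scale1r. Qed.

Lemma qa_scaleDr : right_distributive qa_scale +%R.
Proof.
move=> a x y; rewrite -[x]qa_reprK -[y]qa_reprK.
by rewrite -qa_piD !qa_piZ -qa_piD scalerDr.
Qed.

Lemma qa_scaleDl x : {morph qa_scale^~ x : a b / a + b}.
Proof.
by move=> a b; rewrite -[x]qa_reprK !qa_piZ -qa_piD scalerDl.
Qed.

HB.instance Definition _ := GRing.Zmodule_isLmodule.Build k B
  qa_scaleA qa_scale1 qa_scaleDr qa_scaleDl.

Lemma qa_pi_linear : linear qa_pi.
Proof. by move=> c x y; rewrite qa_piD -qa_piZ. Qed.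

Lemma qa_pi_monoid_morphism : monoid_morphism qa_pi.
Proof. by split=> // x y; rewrite -qa_piM. Qed.

HB.instance Definition _ := GRing.isLinear.Build k kQ B _ qa_pi qa_pi_linear.
HB.instance Definition _ :=
  GRing.isMonoidMorphism.Build kQ B qa_pi qa_pi_monoid_morphism.

Lemma qa_piZE c x : qa_pi (c *: x) = c *: qa_pi x.
Proof. exact: linearZ. Qed.

Lemma qa_piME x y : qa_pi (x * y) = qa_pi x * qa_pi y.
Proof. exact: rmorphM. Qed.

Lemma qa_scaleAl (c : k) (x y : B) : c *: (x * y) = (c *: x) * y.
Proof.
rewrite -[x]qa_reprK -[y]qa_reprK -qa_piME -!qa_piZE.
by rewrite -qa_piME scalerAl.
Qed.

HB.instance Definition _ := GRing.Lmodule_isLalgebra.Build k B qa_scaleAl.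

Lemma qa_scaleAr (c : k) (x y : B) : c *: (x * y) = x * (c *: y).
Proof.
rewrite -[x]qa_reprK -[y]qa_reprK -qa_piME -!qa_piZE.
by rewrite -qa_piME scalerAr.
Qed.

HB.instance Definition _ := GRing.Lalgebra_isAlgebra.Build k B qa_scaleAr.

(* Paths of length at least l lie in J^l, so B is spanned by shorter paths. *)
Lemma long_path l (p : qpath Q) :
  (l <= size (parr p))%N -> ideal_pow (arrow_ideal k Q) l (pbasis k p).
Proof.
elim: l p => [//|l IHl] p; case ps: (parr p) => [//|a s] /= ls.
have := qpath_walk p; rewrite -/(psrc p) -/(parr p) ps => /andP [/eqP av sw].
pose q := @QPath Q (tgt a, s) sw.
have -> : pbasis k p = pbasis k (arrow_path a) * pbasis k q.
  rewrite pbasisM /pbasis_mul /= /ptgt /walk_end /= eqxx; congr (pbasis k _).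
  by apply: qpathP; rewrite ?psrc_pcat ?parr_pcat.
by apply: ideal_pow_mul; [apply: sub_gen_smallest; exists a|exact: IHl].
Qed.

Lemma qa_vector_axiom : {n & Vector.axiom n B}.
Proof.
have [l [_ JI _]] := cid (ideal_set_admissible I).
pose T : finType := (vertex Q * l.-bseq (arrow Q))%type.
have /card_gt0P/sigW [v0 _] := vertex_gt0 Q.
pose pth (t : T) : qpath Q := insubd (trivial_path v0) (t.1, val t.2).
pose g (u : 'rV[k]_#|T|) : B :=
  \sum_(i < #|T|) u 0 i *: qa_pi (pbasis k (pth (enum_val i))).
have g_lin : linear g.
  move=> a x y; rewrite /g scaler_sumr -big_split /=; apply: eq_bigr => i _.
  by rewrite !mxE scalerDl scalerA.
pose gL : {linear _ -> _} := HB.pack g (GRing.isLinear.Build _ _ _ _ g g_lin).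
apply: (@vector_axiom_image k #|T| B gL) => b; rewrite -[b]qa_reprK.
rewrite [repr b]pbasisE.
elim/big_rec: _ => [|p f _ [u gu]]; first by exists 0; rewrite linear0 qa_pi0.
suff [w gw] : exists w, gL w = qa_pi (pbasis k p).
  by exists ((repr b)@_p *: w + u); rewrite linearD linearZ gu gw qa_piD qa_piZE.
have [lp|pl] := leqP l (size (parr p)).
  exists 0; rewrite linear0 -qa_pi0; apply/esym/qa_piE.
  by rewrite subr0; apply/JI/long_path.
pose t : T := (psrc p, Bseq (ltnW pl)).
have pt : pth t = p.
  by rewrite /pth /= /psrc /parr -[X in insubd _ X]surjective_pairing valKd.
exists (delta_mx 0 (enum_rank t)).
rewrite /= /g (bigD1 (enum_rank t)) //= mxE !eqxx scale1r enum_rankK pt.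
by rewrite big1 ?addr0 // => i /negPf ne; rewrite mxE ne andbF scale0r.
Qed.

HB.instance Definition _ := Lmodule_hasFinDim.Build k B (projT2 qa_vector_axiom).
HB.instance Definition _ := Algebra_isFalgebra.Build k B.

End QuiverAlgebra.

(* The points of AlgGr_m(B). In contrast with an arbitrary [{aspace B}], the
   subalgebra must contain the unit of B. *)
Definition AlgGr (k : fieldType) (B : falgType k) (m : nat) : set {aspace B} :=
  [set A : {aspace B} | 1 \in A /\ \dim A = m].

Definition aut_orbit (k : fieldType) (B : falgType k) (A : {aspace B}) :
    set {aspace B} :=
  [set A' : {aspace B} | exists2 phi : 'AEnd(B), bijective phi & asval A' = (phi @: A)%VS].

Arguments AlgGr [k] B m.

(* Main.v *)
(* Write a subalgebra A of codimension one as the kernel of a functional d with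
   d(1) = 0.  For a path p of maximal length such that d(_ p) is not zero,
   maximality gives d(x p) = chi_u(x) d(p), where u is the source of p and
   chi_u : B -> k is the character of the vertex u; after rescaling, p spans a
   complement of A, and associativity forces
     d(x y) = chi_u(x) d(y) + d(x) chi_v(y)
   for some vertex v.  Such a d is determined by d(e_u) and by its values on the
   arrows from u to v.  If d(a) <> 0 for some arrow a and u <> v, conjugation by
   1 + s a, for a suitable scalar s, makes d(e_u) = 0.  If Q is Schur, then a is
   the only arrow on which d is nonzero, and rescaling d gives d(a) = 1; if I is
   monomial, rescaling the arrows is an automorphism of B, which makes all values
   of d on arrows 0 or 1.  If d vanishes on the arrows, rescale to d(e_u) = 1.
   Only finitely many d remain. *)
From HB Require Import structures.
Require Import Defs.
From mathcomp Require Import all_boot all_order all_algebra all_field.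
From mathcomp Require Import boolp classical_sets.
From mathcomp Require Import finmap monalg ring.

Import GRing.Theory.
Local Open Scope ring_scope.
Local Open Scope classical_set_scope.

(** * Hyperplanes, automorphisms and finite unions of orbits *)

Lemma hyperplane_functional {k : fieldType} {vT : vectType k}
    {A : {vspace vT}} {w : vT} :
  \dim A = (\dim {:vT}).-1 -> w \notin A ->
  exists d : {scalar vT}, forall x, (x \in A) = (d x == 0).
Proof.
move=> dimA wA.
have full : (A + <[w]>)%VS = fullv.
  apply/eqP; rewrite eqEdim subvf /=.
  have : (\dim A < \dim (A + <[w]>))%N.
    rewrite (ltn_leqif (dimv_leqif_sup (addvSl A <[w]>))).
    apply: contra wA => sub; apply: subvP sub _ _.
    exact: subvP (addvSr _ _) _ (memv_line w).
  by rewrite dimA; case: (\dim {:vT}).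
have exc x : exists c, x - c *: w \in A.
  have : x \in (A + <[w]>)%VS by rewrite full memvf.
  by case/memv_addP=> y Ay [_ /vlineP[c ->] ->]; exists c; rewrite addrK.
have unic x c c' : x - c *: w \in A -> x - c' *: w \in A -> c = c'.
  move=> cA c'A; apply/eqP; rewrite -subr_eq0; apply: contraNT wA => nz.
  rewrite -[w]scale1r -(mulVf nz) -scalerA memvZ //.
  have -> : (c - c') *: w = (x - c' *: w) - (x - c *: w).
    by rewrite scalerBl addrC [x - c' *: w]addrC addrKA opprK.
  exact: memvB.
(* [d x] is the coordinate of [x] along [w] when the space is split into [A] and the line of [w]. *)
pose d x := xchoose (exc x).
have dP x : x - d x *: w \in A by exact: (xchooseP (exc x)).
have dlin : scalar d.
  move=> c x y; apply: (unic (c *: x + y)) => //.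
  have -> : c *: x + y - (c * d x + d y) *: w =
            c *: (x - d x *: w) + (y - d y *: w).
    by rewrite scalerDl -scalerA scalerBr opprD addrACA.
  by rewrite memvD ?memvZ.
pose dL : {scalar vT} := HB.pack d (GRing.isLinear.Build _ _ _ _ d dlin).
exists dL => x; apply/idP/eqP => [Ax|/= dx0].
  by apply: (unic x) => //; rewrite scale0r subr0.
by have := dP x; rewrite dx0 scale0r subr0.
Qed.

Lemma aend_of_bijection (k : fieldType) (B : falgType k) (f : B -> B) :
  linear f -> monoid_morphism f -> bijective f ->
  exists2 phi : 'AEnd(B), bijective phi & phi =1 f.
Proof.
move=> flin fmul fbij.
pose fL : {linear B -> B} := HB.pack f (GRing.isLinear.Build _ _ _ _ f flin).
have fA : ahom_in {:B} (linfun fL).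
  apply/ahom_inP; case: fmul => f1 fM.
  by split=> [x y _ _|]; rewrite !(lfunE fL) /= ?fM.
have fE : AHom fA =1 f by move=> x; rewrite /= (lfunE fL).
by exists (AHom fA); [exact: eq_bij fbij _ (fsym fE) | exact: fE].
Qed.

Lemma conj_aend {k : fieldType} {B : falgType k} {g h : B} :
  g * h = 1 -> h * g = 1 ->
  exists2 phi : 'AEnd(B), bijective phi & forall x, phi x = h * x * g.
Proof.
move=> gh hg; apply: aend_of_bijection.
- by move=> c x y; rewrite mulrDr mulrDl -scalerAr -scalerAl.
- by split=> [|x y]; rewrite ?mulr1 // !mulrA -[_ * g * h]mulrA gh mulr1.
- exists (fun x => g * x * h) => x.
  + by rewrite !mulrA gh mul1r -mulrA gh mulr1.
  + by rewrite !mulrA hg mul1r -mulrA hg mulr1.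
Qed.

(** Both subalgebras pull back to [K], so [psi] composed with the inverse of [phi] carries [A] onto
    [A']. *)
Lemma orbit_of_common_preimage {k : fieldType} {B : falgType k}
    {K : set B} {phi psi : 'AEnd(B)} {A A' : {aspace B}} :
  bijective phi -> bijective psi ->
  (forall x, phi x \in A <-> K x) -> (forall x, psi x \in A' <-> K x) ->
  aut_orbit A A'.
Proof.
move=> [phi' phiK phi'K] psibij phiA psiA'.
have [|||f fbij fE] := @aend_of_bijection k B (psi \o phi').
- move=> c x y; rewrite -[in LHS](phi'K x) -[in LHS](phi'K y) -linearP /=.
  by rewrite phiK linearP.
- split=> [|x y]; first by rewrite /= -[in LHS](rmorph1 phi) phiK rmorph1.
  by rewrite -[in LHS](phi'K x) -[in LHS](phi'K y) -rmorphM /= phiK rmorphM.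
- exact: bij_comp psibij (Bijective phi'K phiK).
exists f => //; apply/vspaceP => y; apply/idP/memv_imgP => [yA'|[x xA ->]].
  have [psi' _ psi'K] := psibij.
  exists (phi (psi' y)); last by rewrite fE /= phiK psi'K.
  by apply/phiA/psiA'; rewrite psi'K.
by rewrite fE /=; apply/psiA'/phiA; rewrite phi'K.
Qed.

Lemma aut_orbit_AlgGr (k : fieldType) (B : falgType k) (m : nat)
    (A A' : {aspace B}) :
  AlgGr B m A -> aut_orbit A A' -> AlgGr B m A'.
Proof.
move=> [A1 dimA] [phi /bij_inj phi_inj A'E]; split.
  by rewrite A'E -(rmorph1 phi) memv_img.
by rewrite A'E limg_dim_eq //; move/lker0P/eqP: phi_inj => ->; rewrite capv0.
Qed.

(** One representative is chosen for each type [t] that occurs; types may overlap or be empty, the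
    empty ones giving [None]. *)
Lemma finite_union_of_orbits (k : fieldType) (B : falgType k) (m : nat)
    (T : finType) (P : T -> set {aspace B}) :
  (forall A, AlgGr B m A -> exists t, P t A) ->
  (forall t A A', P t A -> P t A' -> aut_orbit A A') ->
  exists s : seq {aspace B}, AlgGr B m = \bigcup_(A in [set` s]) aut_orbit A.
Proof.
move=> Pex Porb.
pose pick t : option {aspace B} :=
  if pselect (exists A, AlgGr B m A /\ P t A) is left ex
  then Some (projT1 (cid ex)) else None.
exists (pmap pick (enum T)); apply/seteqP; split=> [A gA|A' [A]].
  have [t PA] := Pex A gA; have ex : exists A, AlgGr B m A /\ P t A by exists A.
  have [A0 tA0 PA0] : exists2 A0, pick t = Some A0 & P t A0.
    rewrite /pick; case: pselect => // e; case: (cid e) => A0 [? ?] /=.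
    by exists A0.
  exists A0; last exact: Porb PA0 PA.
  by rewrite /= mem_pmap; apply/mapP; exists t; rewrite ?mem_enum.
rewrite /= mem_pmap => /mapP[t _]; rewrite /pick; case: pselect => // e [->].
by case: (cid e) => A0 [? ?] /=; apply: aut_orbit_AlgGr.
Qed.

(** * Vertices and arrows as generators of the quiver algebra *)

Section QuiverAlgebraGenerators.

Set Implicit Arguments.
Unset Strict Implicit.

Variables (k : fieldType) (Q : quiver) (I : admissible_ideal k Q).
Local Notation kQ := (path_algebra k Q).
Local Notation B := (quiver_algebra I).
Implicit Types (u v w : vertex Q) (a : arrow Q) (p q : qpath Q).

Definition path_class p : B := qa_pi I (pbasis k p).
Local Notation E v := (path_class (trivial_path v)).
Local Notation X a := (path_class (arrow_path a)).

Lemma path_classM p q :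
  path_class p * path_class q = if ptgt p == psrc q then path_class (pcat p q) else 0.
Proof.
by rewrite -qa_piME pbasisM /pbasis_mul; case: ifP; rewrite ?qa_pi0.
Qed.

Lemma path_class_arrow_cat a q :
  tgt a = psrc q -> X a * path_class q = path_class (pcat (arrow_path a) q).
Proof. by move=> aq; rewrite path_classM -[ptgt _]/(tgt a) aq eqxx. Qed.

Lemma vertexM u v : E u * E v = if u == v then E u else 0.
Proof.
rewrite path_classM -[ptgt _]/u -[psrc _]/v; case: eqP => [<-|//].
by rewrite (pcat1p (trivial_path u)).
Qed.

Lemma vertex_arrow u a : E u * X a = if u == src a then X a else 0.
Proof.
rewrite path_classM -[ptgt _]/u -[psrc _]/(src a); case: eqP => [->|//].
by rewrite (pcat1p (arrow_path a)).
Qed.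

Lemma arrow_vertex a v : X a * E v = if tgt a == v then X a else 0.
Proof.
rewrite path_classM -[ptgt _]/(tgt a) -[psrc _]/v; case: eqP => [<-|//].
by rewrite (pcatp1 (arrow_path a)).
Qed.

Lemma arrowM_eq0 a b : tgt a <> src b -> X a * X b = 0.
Proof. by move=> ab; rewrite path_classM; case: eqP. Qed.

Lemma vertex_sum : \sum_v E v = 1.
Proof. by rewrite -(raddf_sum (qa_pi I)) -(rmorph1 (qa_pi I)). Qed.

Lemma qpath_ind (P : qpath Q -> Prop) :
  (forall v, P (trivial_path v)) ->
  (forall a q, tgt a = psrc q -> P q -> P (pcat (arrow_path a) q)) ->
  forall p, P p.
Proof.
move=> Pv Pa p; case ps: (parr p) => [|a s].
  by rewrite (_ : p = trivial_path (psrc p)) //; apply: qpathP.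
elim: s a p ps => [|b s IHs] a p ps.
  have /= := qpath_walk p; rewrite -/(psrc p) -/(parr p) ps /= andbT => /eqP ap.
  rewrite (_ : p = pcat (arrow_path a) (trivial_path (tgt a))); first exact: Pa.
  by apply: qpathP; rewrite ?psrc_pcat ?parr_pcat.
have /= := qpath_walk p; rewrite -/(psrc p) -/(parr p) ps => /andP[/eqP ap wp].
pose q := @QPath Q (tgt a, b :: s) wp.
rewrite (_ : p = pcat (arrow_path a) q); first by apply: Pa => //; exact: IHs.
by apply: qpathP; rewrite ?psrc_pcat ?parr_pcat.
Qed.

(** Path classes span [B], and a nontrivial path is an arrow followed by a shorter path, so products
    with an arrow on the left suffice. *)
Lemma generators_ind (P : B -> Prop) :
  P 0 -> (forall c x y, P x -> P y -> P (c *: x + y)) ->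
  (forall v, P (E v)) -> (forall a x, P (X a) -> P x -> P (X a * x)) ->
  (forall a, P (X a)) -> forall x, P x.
Proof.
move=> P0 PD PE PM PX x; rewrite -[x]qa_reprK [repr x]pbasisE.
elim/big_rec: _ => [|p f _ Pf]; first by rewrite qa_pi0.
rewrite qa_piD qa_piZE; apply: PD => //; elim/qpath_ind: p => [|a q aq Pq] //.
by rewrite -/(path_class _) -path_class_arrow_cat //; apply: PM.
Qed.

(** Some power of the arrow ideal lies in [I]. The first half bounds the length of nonzero paths;
    the second makes characters vanish on arrows. *)
Lemma radical_nilpotent : exists l : nat,
  (forall p, (l <= size (parr p))%N -> path_class p = 0) /\ (forall a, X a ^+ l = 0).
Proof.
have [l [_ JI _]] := ideal_set_admissible I; exists l; split=> [p lp|a].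
  by rewrite /path_class -(qa_pi0 I); apply/qa_piE; rewrite subr0; apply/JI/long_path.
rewrite -(rmorphXn (qa_pi I)) -(qa_pi0 I); apply/qa_piE; rewrite subr0; apply: JI.
elim: l => [//|l IHl]; rewrite exprS; apply: ideal_pow_mul => //.
by apply: sub_gen_smallest; exists a.
Qed.

(** * Characters of the vertices and derivations between them *)

Lemma ideal_trivial_coef v (f : kQ) : ideal_set I f -> f@_(trivial_path v) = 0.
Proof.
have [l [_ _ IJ]] := ideal_set_admissible I.
pose Z : set kQ := [set f | f@_(trivial_path v) = 0].
have idZ : two_sided_ideal Z.
  split=> [|x y|a x|a x]; rewrite /Z /= ?mcoeff0 ?mcoeffD ?mcoeff_triv_mul //.
  - by move=> -> ->; rewrite addr0.
  - by move=> ->; rewrite mulr0.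
  - by move=> ->; rewrite mul0r.
move=> /IJ; rewrite -[_ = 0]/(Z f); move: f.
apply: smallest_sub => // _ [x Jx [y _ <-]].
have [_ _ _ Zr] := idZ; apply: Zr; move: x Jx.
by apply: smallest_sub => // _ [a _ <-]; rewrite /Z /= mcoeff_pbasis; case: eqP.
Qed.

(** The choice of representative is harmless, because elements of [I] have zero coefficient at every
    trivial path. *)
Definition chi v (x : B) : k := (repr x)@_(trivial_path v).

Lemma chi_pi v f : chi v (qa_pi I f) = f@_(trivial_path v).
Proof.
apply/eqP; rewrite -subr_eq0 -mcoeffB ideal_trivial_coef //.
exact: qa_repr_pi.
Qed.

Lemma chi_scalar v : scalar (chi v).
Proof.
move=> c x y; rewrite -[x]qa_reprK -[y]qa_reprK -qa_piZE -qa_piD !chi_pi mcoeffD.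
by rewrite mcoeffZ.
Qed.

HB.instance Definition _ v := GRing.isLinear.Build k B k _ (chi v) (chi_scalar v).

Lemma chiM v x y : chi v (x * y) = chi v x * chi v y.
Proof.
by rewrite -[x]qa_reprK -[y]qa_reprK -qa_piME !chi_pi mcoeff_triv_mul.
Qed.

Lemma chi1 v : chi v 1 = 1.
Proof. by rewrite -(rmorph1 (qa_pi I)) chi_pi pa_one_coef. Qed.

Lemma chi_vertex v u : chi v (E u) = (v == u)%:R.
Proof.
rewrite chi_pi mcoeff_pbasis eq_sym; congr (_%:R); congr nat_of_bool.
by apply/eqP/eqP => [[->]|->].
Qed.

Lemma chi_arrow v a : chi v (X a) = 0.
Proof. by rewrite chi_pi mcoeff_pbasis; case: eqP. Qed.

(** A character kills the nilpotent arrows. As the vertices sum to 1, it is nonzero on some [E v];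
    orthogonality of the idempotents then fixes its values on all vertices. *)
Lemma character_is_chi (beta : {scalar B}) :
  beta 1 = 1 -> (forall x y, beta (x * y) = beta x * beta y) ->
  exists v, beta =1 chi v.
Proof.
move=> beta1 betaM.
have betaX a : beta (X a) = 0.
  have [l [_ /(_ a) Xl]] := radical_nilpotent.
  have betaXn n x : beta (x ^+ n) = beta x ^+ n.
    by elim: n => [|n IHn]; rewrite ?beta1 // !exprS betaM IHn.
  have := betaXn l (X a); rewrite Xl linear0 => /esym/eqP.
  by rewrite expf_eq0 => /andP[_ /eqP].
have [v betav] : exists v, beta (E v) != 0.
  apply/existsP; apply: contra_eqT beta1 => /existsPn beta0.
  rewrite -vertex_sum linear_sum big1 1?eq_sym ?oner_eq0 // => v _.
  by have := beta0 v; rewrite negbK => /eqP.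
exists v; apply: generators_ind => [|c x y IHx IHy|u|a x Pa Px|a].
- by rewrite !linear0.
- by rewrite !linearP IHx IHy.
- rewrite chi_vertex; case: eqVneq => [<-|vu].
    apply: (mulfI betav); rewrite mulr1 -betaM vertexM eqxx //.
  by apply: (mulfI betav); rewrite mulr0 -betaM vertexM (negbTE vu) linear0.
- by rewrite betaM chiM Pa Px.
- by rewrite betaX chi_arrow.
Qed.

(** These are the derivations of [B] into the one-dimensional bimodule with left action [chi u] and
    right action [chi v]. *)
Definition vertex_derivation u v (d : B -> k) : Prop :=
  forall x y, d (x * y) = chi u x * d y + d x * chi v y.

(** Apply the rule to the idempotent [E w]. The factor 0 or 2 forces [d (E w)] to vanish, in every
    characteristic; only the factor 1 leaves it free. *)
Lemma derivation_vertex_id u v (d : {scalar B}) w :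
  vertex_derivation u v d -> d (E w) = ((u == w)%:R + (v == w)%:R) * d (E w).
Proof.
move=> dD; have := dD (E w) (E w).
by rewrite vertexM eqxx !chi_vertex mulrDl [d _ * _]mulrC.
Qed.

Lemma derivation_tgt u v (d : {scalar B}) :
  vertex_derivation u v d -> u != v -> d (E v) = - d (E u).
Proof.
move=> dD uv; have := dD (E u) (E v).
rewrite vertexM (negbTE uv) !chi_vertex !eqxx linear0 mul1r mulr1.
by move/esym/eqP; rewrite addr_eq0 => /eqP.
Qed.

Lemma derivation_other u v (d : {scalar B}) w :
  vertex_derivation u v d -> w != u -> w != v -> d (E w) = 0.
Proof.
move=> dD wu wv; rewrite (derivation_vertex_id w dD).
by rewrite eq_sym (negbTE wu) eq_sym (negbTE wv) addr0 mul0r.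
Qed.

Lemma derivation_loop u (d : {scalar B}) :
  vertex_derivation u u d -> d (E u) = 0.
Proof.
move=> dD; have /eqP := derivation_vertex_id u dD.
by rewrite eqxx mulrDl mul1r addrC eq_sym -subr_eq0 addrK => /eqP.
Qed.

(** On vertices, [d] is determined by [d (E u)]: it changes sign at [v] if [v] differs from [u], and
    vanishes at all others. *)
Lemma derivation_ext u v (d d' : {scalar B}) :
  vertex_derivation u v d -> vertex_derivation u v d' ->
  d (E u) = d' (E u) -> (forall a, d (X a) = d' (X a)) -> d =1 d'.
Proof.
move=> dD d'D du da; apply: generators_ind => [|c x y IHx IHy|w|a x Pa Px|//].
- by rewrite !linear0.
- by rewrite !linearP IHx IHy.
- case: (eqVneq w u) => [->//|wu]; case: (eqVneq w v) => [wv|wv].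
    by rewrite wv !(@derivation_tgt u v) ?du // -wv eq_sym.
  by rewrite !(@derivation_other u v).
- by rewrite dD d'D Pa Px.
Qed.

(** Multiply the arrow by the idempotents of its source and target; [chi] kills arrows and detects
    the vertex. *)
Lemma derivation_arrow u v (d : {scalar B}) a :
  vertex_derivation u v d -> d (X a) != 0 -> src a = u /\ tgt a = v.
Proof.
move=> dD da; split; apply/eqP; apply: contraNT da => ne.
  have := dD (E (src a)) (X a); rewrite vertex_arrow eqxx chi_vertex chi_arrow.
  by rewrite eq_sym (negbTE ne) mul0r mulr0 addr0 => ->.
have := dD (X a) (E (tgt a)); rewrite arrow_vertex eqxx chi_vertex chi_arrow.
by rewrite eq_sym (negbTE ne) mul0r mulr0 addr0 => ->.
Qed.

(** The character [chi u] on the left comes from a longest path that [d] detects, [chi v] on the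
    right from associativity. *)
Lemma multiplicative_kernel_derivation (d : {scalar B}) :
  d 1 = 0 -> (exists x, d x != 0) ->
  (forall x y, d x = 0 -> d y = 0 -> d (x * y) = 0) ->
  exists u v, vertex_derivation u v d.
Proof.
move=> d1 [x1 dx1] dker.
pose P n := `[< exists p x, size (parr p) = n /\ d (x * path_class p) != 0 >].
have Psize p x : d (x * path_class p) != 0 -> P (size (parr p)).
  by move=> nz; apply/asboolP; exists p, x.
have exP : exists n, P n.
  apply: contrapT => noP; move/eqP: dx1; apply; rewrite -[x1]mul1r.
  have d0 p x : d (x * path_class p) = 0.
    by apply: contrapT => /eqP /Psize; apply: contra_not noP; exists (size (parr p)).
  (* The left factor is generalized because the product case moves an arrow into it. *)
  move: (1 : B); move: x1; apply: generators_ind => [|c y z IHy IHz|v|a y _ IHy|a] x.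
  - by rewrite mulr0 linear0.
  - by rewrite mulrDr -scalerAr linearP IHy IHz mulr0 addr0.
  - exact: d0.
  - by rewrite mulrA IHy.
  - exact: d0.
have [l [longp _]] := radical_nilpotent.
have ubP n : P n -> (n <= l)%N.
  case/asboolP=> p [x [<- nz]]; rewrite leqNgt; apply: contra nz => /ltnW lp.
  by rewrite longp // mulr0 linear0.
have [n /asboolP[p [x0 [sp nz]]] nmax] := ex_maxnP exP ubP.
pose u := psrc p.
(* An arrow in front of [p] gives 0 or a longer path, which maximality excludes; hence [y] acts
   through [chi u]. *)
have semi y z : d (z * y * path_class p) = chi u y * d (z * path_class p).
  move: y z; apply: generators_ind => [|c x y IHx IHy|v|a x IHa IHx|a] z.
  - by rewrite mulr0 mul0r !linear0 mul0r.
  - rewrite mulrDr mulrDl -scalerAr -scalerAl !linearP IHx IHy /=.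
    by rewrite mulrDl mulrA.
  - rewrite chi_vertex -mulrA path_classM -[ptgt _]/v -/u eq_sym; case: eqP => [<-|_].
      by rewrite (pcat1p p) mul1r.
    by rewrite mulr0 mul0r linear0.
  - by rewrite mulrA IHx IHa chiM mulrA [chi u x * _]mulrC.
  - rewrite chi_arrow mul0r -mulrA path_classM -[ptgt _]/(tgt a).
    case: eqP => [ap|_]; last by rewrite mulr0 linear0.
    apply: contrapT => /eqP /Psize /nmax.
    by rewrite (parr_pcat (p := arrow_path a)) //= sp ltnn.
have dp : d (path_class p) != 0.
  by apply: contra nz => /eqP dp0; have := semi x0 1; rewrite !mul1r dp0 mulr0 => ->.
pose w := (d (path_class p))^-1 *: path_class p.
have dw : d w = 1 by rewrite linearZ /= mulVf.
have dmulw y : d (y * w) = chi u y.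
  have := semi y 1; rewrite !mul1r => dyp.
  by rewrite -scalerAr linearZ /= dyp mulrC mulfK.
move: w dw dmulw => w dw dmulw.
(* The only possible right-hand factor: solve the desired rule for the product [w * y], using
   [d w = 1]. *)
pose beta y := d (w * y) - d y * chi u w.
have beta_lin : scalar beta.
  move=> c y z; rewrite /beta mulrDr -scalerAr !linearP /=; ring.
pose betaL : {scalar B} := HB.pack beta (GRing.isLinear.Build _ _ _ _ beta beta_lin).
have dD x y : d (x * y) = chi u x * d y + d x * beta y.
  have subZ (f : {scalar B}) y' z c : f (y' - c *: z) = f y' - c * f z.
    by rewrite linearB linearZ.
  (* Subtracting multiples of [w] projects to the kernel of [d]; expanding the product of two such
     projections gives the rule. *)
  have dk z : d (z - d z *: w) = 0 by rewrite subZ dw mulr1 subrr.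
  have := dker _ _ (dk x) (dk y).
  have -> : (x - d x *: w) * (y - d y *: w) =
            x * y - d x *: (w * y) - d y *: ((x - d x *: w) * w).
    by rewrite mulrBr mulrBl -scalerAl -scalerAr.
  rewrite !subZ dmulw (subZ (chi u)) /beta => /eqP.
  rewrite subr_eq0 subr_eq => /eqP ->; ring.
have beta1 : beta 1 = 1 by rewrite /beta mulr1 d1 dw mul0r subr0.
(* Compare the two expansions of [d] on [w * y * z]. *)
have betaM y z : beta (y * z) = beta y * beta z.
  have := dD (w * y) z; rewrite -mulrA !dD chiM dw !mul1r => e.
  by apply: (addrI (chi u w * (chi u y * d z + d y * beta z))); rewrite e; ring.
have [v bv] := @character_is_chi betaL beta1 betaM.
by exists u, v => x y; rewrite dD -bv.
Qed.

Lemma derivation_comp u v (d : {scalar B}) (phi : 'AEnd(B)) :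
  (forall w x, chi w (phi x) = chi w x) -> vertex_derivation u v d ->
  vertex_derivation u v (d \o phi).
Proof. by move=> chiphi dD x y; rewrite /= rmorphM dD !chiphi. Qed.

(** For distinct [u] and [v], conjugation by [1 + s *: X a] adds to [d] the multiple [s * d (X a)]
    of [chi u - chi v], which vanishes on arrows. For [u = v] the identity works. *)
Lemma derivation_conj u v (d : {scalar B}) a :
  vertex_derivation u v d -> d (X a) != 0 ->
  exists phi : 'AEnd(B), [/\ bijective phi, vertex_derivation u v (d \o phi),
    d (phi (E u)) = 0 & forall b, d (phi (X b)) = d (X b)].
Proof.
move=> dD da; have [au av] := derivation_arrow dD da.
case: (eqVneq u v) => [uv|uv].
  have id_bij : bijective (id_ahom B) by exists id => x; rewrite /= id_lfunE.
  have dL : vertex_derivation u u d by rewrite {2}uv.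
  exists (id_ahom B); split=> [//|x y||b]; rewrite /= !id_lfunE //.
  exact: derivation_loop dL.
(* The scalar for which the added term cancels [d (E u)]. *)
pose s := - (d (E u) / d (X a)).
have XX : X a * X a = 0 by rewrite arrowM_eq0 // au av; apply/eqP; rewrite eq_sym.
have d1 : d 1 = 0.
  have := dD 1 1; rewrite mulr1 !chi1 mul1r mulr1 => /eqP.
  by rewrite -subr_eq0 opprD addrA subrr sub0r oppr_eq0 => /eqP.
have [g gh] : exists g : k -> B,
    [/\ forall r r', r + r' = 0 -> g r * g r' = 1, forall w r, chi w (g r) = 1 &
        forall r, d (g r) = r * d (X a)].
  exists (fun r => 1 + r *: X a); split=> [r r' rr|w r|r].
  - rewrite mulrDl mul1r mulrDr mulr1 -scalerAl -scalerAr XX !scaler0 addr0.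
    by rewrite addrAC -addrA -scalerDl rr scale0r addr0.
  - by rewrite linearD linearZ /= chi1 chi_arrow mulr0 addr0.
  - by rewrite linearD linearZ /= d1 add0r.
have [gg chig dg] := gh.
have [phi phibij phiE] := conj_aend (gg s (- s) (subrr s)) (gg (- s) s (addNr s)).
have chiphi w x : chi w (phi x) = chi w x.
  by rewrite phiE !chiM !chig mul1r mulr1.
have dphi x : d (phi x) = d x + s * d (X a) * (chi u x - chi v x).
  by rewrite phiE !dD !chiM !chig !dg; ring.
exists phi; split=> //; first exact: derivation_comp.
  rewrite dphi !chi_vertex eqxx [v == u]eq_sym (negbTE uv).
  by rewrite subr0 mulr1 /s mulNr divfK ?subrr.
by move=> b; rewrite dphi !chi_arrow subrr mulr0 addr0.
Qed.

End QuiverAlgebraGenerators.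

(** * Rescaling the arrows *)

Definition path_weight {k : fieldType} {Q : quiver} (t : arrow Q -> k)
    (p : qpath Q) : k :=
  \prod_(a <- parr p) t a.

HB.lock Definition torus {k : fieldType} {Q : quiver} (t : arrow Q -> k)
    (f : path_algebra k Q) : path_algebra k Q :=
  \sum_(p <- msupp f) (path_weight t p * f@_p) *: pbasis k p.

Section Torus.

Set Implicit Arguments.
Unset Strict Implicit.

Variables (k : fieldType) (Q : quiver).
Local Notation kQ := (path_algebra k Q).
Implicit Types (t : arrow Q -> k) (p q : qpath Q) (f g h : kQ) (c : k).

Lemma path_coefZ c f q : (c *: f)@_q = c * f@_q.
Proof. exact: mcoeffZ. Qed.

Lemma path_coefP c f g q : (c *: f + g)@_q = c * f@_q + g@_q.
Proof. by rewrite -path_coefZ; exact: mcoeffD. Qed.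

Lemma mcoeff_torus t f q : (torus t f)@_q = path_weight t q * f@_q.
Proof.
have coefZ c p : (c *: pbasis k p)@_q = c * (p == q)%:R.
  by rewrite path_coefZ mcoeff_pbasis.
rewrite torus.unlock (raddf_sum (mcoeff q)) (eq_bigr _ (fun p _ => coefZ _ p)).
case: (boolP (q \in msupp f)) => [qf|/mcoeff_outdom fq].
  rewrite (big_fsetD1 q) //= eqxx mulr1 big_seq big1 ?addr0 // => p.
  by rewrite !inE => /andP[/negbTE -> _]; rewrite mulr0.
rewrite fq mulr0 big1 // => p _; case: eqP => [->|_]; last by rewrite mulr0.
by rewrite fq mulr0 mul0r.
Qed.

Lemma torus_linear t : linear (torus t).
Proof.
move=> c f g; apply/malgP => q.
rewrite mcoeff_torus [X in _ * X]path_coefP [RHS]path_coefP !mcoeff_torus.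
by rewrite mulrDr mulrCA.
Qed.

HB.instance Definition _ t := GRing.isLinear.Build k kQ kQ _ (torus t) (torus_linear t).

Lemma torus0 t : torus t 0 = 0.
Proof. exact: linear0. Qed.

Lemma torus_path t p : torus t (pbasis k p) = path_weight t p *: pbasis k p.
Proof.
apply/malgP => q; rewrite mcoeff_torus path_coefZ mcoeff_pbasis.
by case: eqP => [->|_]; rewrite ?mulr0.
Qed.

Lemma path_algebra_ind (P : kQ -> Prop) :
  P 0 -> (forall c p f, P f -> P (c *: pbasis k p + f)) -> forall f, P f.
Proof.
by move=> P0 PD f; rewrite [f]pbasisE; elim/big_rec: _ => // p g _; apply: PD.
Qed.

Lemma path_mulPl c f g h : (c *: f + g) * h = c *: (f * h) + g * h.
Proof. by rewrite mulrDl scalerAl. Qed.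

Lemma path_mulPr c f g h : h * (c *: f + g) = c *: (h * f) + h * g.
Proof. by rewrite mulrDr scalerAr. Qed.

Lemma path_mulZZ c c' f g : (c *: f) * (c' *: g) = (c * c') *: (f * g).
Proof. by rewrite -scalerA scalerAr scalerAl. Qed.

Lemma torus_pathM t p q :
  torus t (pbasis k p * pbasis k q) = torus t (pbasis k p) * torus t (pbasis k q).
Proof.
rewrite !torus_path path_mulZZ pbasisM /pbasis_mul.
case: eqP => [pq|_]; last by rewrite torus0 scaler0.
by rewrite torus_path /path_weight (parr_pcat pq) big_cat.
Qed.

Lemma torus_pathMl t p g : torus t (pbasis k p * g) = torus t (pbasis k p) * torus t g.
Proof.
elim/path_algebra_ind: g => [|c q g IHg]; first by rewrite mulr0 torus0 mulr0.
rewrite (path_mulPr c (pbasis k q) g) 2!torus_linear IHg torus_pathM.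
by rewrite (path_mulPr c (torus t (pbasis k q)) (torus t g)).
Qed.

Lemma torusM t f g : torus t (f * g) = torus t f * torus t g.
Proof.
elim/path_algebra_ind: f => [|c p f IHf]; first by rewrite mul0r torus0 mul0r.
rewrite (path_mulPl c (pbasis k p) f g) 2!torus_linear IHf torus_pathMl.
by rewrite (path_mulPl c (torus t (pbasis k p)) (torus t f) (torus t g)).
Qed.

Lemma torus1 t : torus t 1 = 1.
Proof.
rewrite -[1]/(pa_one k Q) /pa_one (raddf_sum (torus t)); apply: eq_bigr => v _.
by rewrite /= torus_path /path_weight big_nil scale1r.
Qed.

Lemma torusV t f : (forall a, t a != 0) -> torus (fun a => (t a)^-1) (torus t f) = f.
Proof.
move=> t0; apply/malgP => q; rewrite !mcoeff_torus mulrA -big_split /=.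
by rewrite big1 ?mul1r // => a _; rewrite mulVf.
Qed.

(** The preimage of [I] under [torus t] is an ideal, and it contains the generating paths since
    these are only rescaled. *)
Lemma torus_monomial t (I : set kQ) : monomial I ->
  forall f, I f -> I (torus t f).
Proof.
move=> [P IE]; have [I0 ID Il Ir] := ideal_genP [set pbasis k p | p in P].
rewrite IE; apply: smallest_sub => [|_ [p Pp <-]].
  by split=> [|x y Ix Iy|a x Ix|a x Ix]; rewrite /= ?linear0 ?linearD ?torusM;
    [exact: I0 | exact: ID | exact: Il | exact: Ir].
rewrite /= torus_path -[pbasis k p]mul1r scalerAl; apply: Il.
by apply: sub_gen_smallest; exists p.
Qed.

(** Both [torus t] and the rescaling by the inverse scalars preserve [I], so they descend to
    mutually inverse maps. *)
Lemma torus_aend (I : admissible_ideal k Q) t :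
  monomial I -> (forall a, t a != 0) ->
  exists2 phi : 'AEnd(quiver_algebra I), bijective phi &
    forall f, phi (qa_pi I f) = qa_pi I (torus t f).
Proof.
move=> Imon t0.
have [F Fpi] : exists F : (arrow Q -> k) -> quiver_algebra I -> quiver_algebra I,
    forall s f, F s (qa_pi I f) = qa_pi I (torus s f).
  exists (fun s x => qa_pi I (torus s (repr x))) => s f; apply/qa_piE.
  rewrite -(raddfB (torus s)); apply: torus_monomial Imon _ _; exact: qa_repr_pi.
have surj (x : quiver_algebra I) : exists f, x = qa_pi I f.
  by exists (repr x); rewrite qa_reprK.
have [|||phi phibij phiE] := @aend_of_bijection _ _ (F t).
- move=> c x y; have [[f ->] [g ->]] := (surj x, surj y).
  rewrite -[X in F t X](qa_pi_linear I c f g) !Fpi torus_linear.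
  exact: qa_pi_linear.
- split=> [|x y]; first by rewrite -(rmorph1 (qa_pi I)) Fpi torus1.
  have [[f ->] [g ->]] := (surj x, surj y).
  by rewrite -qa_piME !Fpi torusM qa_piME.
- have tV a : (t a)^-1 != 0 by rewrite invr_eq0.
  have tVV : (fun a => (t a)^-1^-1) = t by apply/funext => a; rewrite invrK.
  exists (F (fun a => (t a)^-1)) => x; have [f ->] := surj x; rewrite !Fpi.
    by rewrite torusV.
  by have := torusV f tV; rewrite tVV => ->.
by exists phi => // f; rewrite phiE Fpi.
Qed.

End Torus.

(** * Normal forms of derivations *)

Section NormalForms.

Set Implicit Arguments.
Unset Strict Implicit.

Variables (k : fieldType) (Q : quiver) (I : admissible_ideal k Q).
Local Notation B := (quiver_algebra I).
Local Notation E v := (path_class I (trivial_path v)).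
Local Notation X a := (path_class I (arrow_path a)).

(** The finite data [(u, v, b, S)] determine [d], by [derivation_ext]. *)
Definition normal_derivation (u v : vertex Q) (b : bool) (S : {set arrow Q})
    (d : B -> k) : Prop :=
  [/\ vertex_derivation u v d, d (E u) = b%:R &
      forall a, d (X a) = (a \in S)%:R].

Lemma scale_derivation (u v : vertex Q) (d : {scalar B}) (c : k) :
  vertex_derivation u v d -> exists d' : {scalar B},
    vertex_derivation u v d' /\ forall x, d' x = c * d x.
Proof.
move=> dD; have dlin : scalar (fun x : B => c * d x).
  by move=> e x y; rewrite linearP /= mulrDr mulrCA.
pose d' : {scalar B} := HB.pack (fun x : B => c * d x)
  (GRing.isLinear.Build _ _ _ _ (fun x : B => c * d x) dlin).
by exists d'; split=> // x y; rewrite /= dD; ring.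
Qed.

Lemma normalize_derivation (u v : vertex Q) (d : {scalar B}) :
  schur Q \/ monomial I -> vertex_derivation u v d -> (exists x, d x != 0) ->
  exists (b : bool) (S : {set arrow Q}) (d' : {scalar B}) (phi : 'AEnd(B)),
    [/\ normal_derivation u v b S d', bijective phi &
        forall x, d (phi x) = 0 <-> d' x = 0].
Proof.
move=> QI dD dnz.
have id_bij : bijective (id_ahom B) by exists id => x; rewrite /= id_lfunE.
have mulc0 (c y : k) : c != 0 -> (y = 0 <-> c * y = 0).
  by move=> c0; split=> [->|/eqP]; rewrite ?mulr0 // mulf_eq0 (negbTE c0) => /eqP.
case: (pselect (exists a, d (X a) != 0)) => [[a da]|noarrow]; last first.
  have d0 a : d (X a) = 0.
    by apply: contrapT => /eqP da; apply: noarrow; exists a.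
  have du : d (E u) != 0.
    (* If [d (E u)] were 0, then [d] would agree with the zero derivation on generators. *)
    case: dnz => x; apply: contra => /eqP du.
    apply/eqP; apply: (@derivation_ext _ _ _ u v d \0) => // y z.
    by rewrite /= mulr0 mul0r addr0.
  have [d' [d'D d'E]] := scale_derivation (d (E u))^-1 dD.
  exists true, finset.set0, d', (id_ahom B); split=> //; last first.
    by move=> x; rewrite /= id_lfunE d'E; apply: mulc0; rewrite invr_eq0.
  by split=> // [|a]; rewrite d'E ?mulVf // d0 mulr0 inE.
have [phi [phibij dphiD dphiu dphia]] := derivation_conj dD da.
case: QI => [Qschur|Imon].
  have [d' [d'D d'E]] := @scale_derivation u v (d \o phi) (d (X a))^-1 dphiD.
  exists false, [set a]%SET, d', phi; split=> //; last first.
    by move=> x; rewrite d'E; apply: mulc0; rewrite invr_eq0.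
  split=> // [|b]; rewrite d'E /= ?dphiu ?mulr0 // dphia inE.
  case: eqVneq => [->|ba]; first by rewrite mulVf.
  (* A second arrow on which [d] is nonzero would be parallel to [a]. *)
  apply/eqP; rewrite mulf_eq0 invr_eq0 (negbTE da) /=; apply: contraNT ba => db.
  have [su tv] := derivation_arrow dD da; have [su' tv'] := derivation_arrow dD db.
  by apply/eqP/Qschur; rewrite ?su ?su' ?tv ?tv'.
(* The default 1 keeps every scalar invertible, as an automorphism requires. *)
pose t b := if d (X b) == 0 then 1 else (d (X b))^-1.
have t0 b : t b != 0 by rewrite /t; case: ifPn; rewrite ?oner_eq0 ?invr_eq0.
have [psi psibij psiE] := torus_aend Imon t0.
have psiv w : psi (E w) = E w by rewrite psiE torus_path /path_weight big_nil scale1r.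
have psia b : psi (X b) = t b *: X b.
  by rewrite psiE torus_path /path_weight big_seq1 qa_piZE.
(* Rescaling arrows preserves the characters, so composing with [psi] keeps the derivation rule for
   the same [u] and [v]. *)
have chipsi w x : chi w (psi x) = chi w x.
  elim/generators_ind: x => [|c x y IHx IHy|z|b x Pb Px|b].
  - by rewrite !linear0.
  - by rewrite (linearP psi) 2!(linearP (chi w)) /= IHx IHy.
  - by rewrite psiv.
  - by rewrite rmorphM !chiM Pb Px.
  - by rewrite psia linearZ /= chi_arrow mulr0.
exists false, [set b | d (X b) != 0]%SET, (d \o phi \o psi), (comp_ahom phi psi); split.
- split=> [||b]; first exact: (@derivation_comp _ _ _ u v (d \o phi)).
  + by rewrite /= psiv.
  + rewrite /= psia !linearZ /= dphia inE /t.
    by case: eqVneq => [->|nz]; rewrite ?mulr0 ?mulVf.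
- apply: eq_bij (bij_comp phibij psibij) _ _ => x.
  by rewrite /= comp_lfunE.
- by move=> x; rewrite /= comp_lfunE.
Qed.

End NormalForms.

(** * Finiteness of the set of orbits *)

Theorem corollary5p3 (k : closedFieldType) (Q : quiver)
    (I : admissible_ideal k Q) :
  schur Q \/ monomial I ->
  exists s : seq {aspace (quiver_algebra I)},
    AlgGr (quiver_algebra I) (\dim {: quiver_algebra I}).-1 =
      \bigcup_(A in [set` s]) aut_orbit A.
Proof.
move=> QI.
pose T : finType := (vertex Q * vertex Q * bool * {set arrow Q})%type.
(* [A] has type [t] if some automorphism carries the kernel of a normal derivation of type [t] onto
   it. *)
pose P (t : T) : set {aspace (quiver_algebra I)} := [set A : {aspace (quiver_algebra I)} |
  exists (d : {scalar quiver_algebra I}) (phi : 'AEnd(quiver_algebra I)),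
    [/\ normal_derivation t.1.1.1 t.1.1.2 t.1.2 t.2 d, bijective phi &
        forall x, phi x \in A <-> d x = 0]].
apply: (@finite_union_of_orbits _ _ _ T P) => [A [A1 dimA]|t A A'].
  have [w wA] : exists w, w \notin A.
    apply: contrapT => noA; have : (\dim {:quiver_algebra I} <= \dim A)%N.
      apply/dimvS/subvP => x _; apply: contrapT => /negP xA.
      by apply: noA; exists x.
    (* Positivity excludes the degenerate case where the predecessor of 0 is 0. *)
    have : (0 < \dim A)%N by rewrite adim_gt0.
    by rewrite dimA; case: (\dim _) => // n _; rewrite ltnn.
  have [d dA] := hyperplane_functional dimA wA.
  have [||x y|u [v dD]] := @multiplicative_kernel_derivation _ _ _ d.
  - by apply/eqP; rewrite -dA.
  - by exists w; rewrite -dA.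
  - by move=> /eqP dx /eqP dy; apply/eqP; rewrite -dA memvM // dA.
  have dnz : exists x, d x != 0 by exists w; rewrite -dA.
  have [b [S [d' [phi [d'N phibij phiE]]]]] := normalize_derivation QI dD dnz.
  exists (u, v, b, S), d', phi; split=> // x.
  by rewrite dA; split=> [/eqP/phiE|/phiE ->].
(* Normal derivations of the same type coincide, so [A] and [A'] have the kernel of [d] as common
   preimage. *)
move=> [d [phi [[dD du da] phibij phiA]]] [d' [psi [[d'D d'u d'a] psibij psiA']]].
apply: (orbit_of_common_preimage phibij psibij phiA) => x.
rewrite (@derivation_ext _ _ _ t.1.1.1 t.1.1.2 d d') // ?du // => a.
by rewrite da d'a.
Qed.
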